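(* Let $n\ge 3$, let $M$ be an $n$-dimensional manifold with coordinates $(x^1,\dots,x^n)$ and induced tangent bundle coordinates $(x^i,y^i)$, let $f=f(x^1)$ be a positive smooth function whose derivative $f'$ is not identically zero, let $(c_{\lambda\mu})_{2\le\lambda,\mu\le n}$ be a non-singular symmetric matrix of real constants, and put $$\beta=f(x^1)\,y^1,\qquad \alpha=f(x^1)\sqrt{(y^1)^2+\varphi},\qquad \varphi=\sum_{\lambda,\mu=2}^n c_{\lambda\mu}y^\lambda y^\mu .$$ Let $a\ne 0$ be a real constant. Then the (non-regular) Finsler metric $$F=\left(a\beta+\sqrt{\alpha^2-\beta^2}\right)\exp\!\left(\frac{a\beta}{a\beta+\sqrt{\alpha^2-\beta^2}}\right)$$ is a Landsberg metric which is not Berwaldian. Moreover, the coefficients of the geodesic spray of $F$ are $$G^1=\left(\frac{2f(x^1)^2(y^1)^2-\alpha^2}{2f(x^1)^2}+\frac{a^2-1}{2a^2}\,\frac{\alpha^2-\beta^2}{f(x^1)^2}\right)\frac{f'(x^1)}{f(x^1)},\qquad G^\mu=P\,y^\mu\quad(\mu=2,\dots,n),$$ where $$P=\left(y^1+\frac{1}{a f(x^1)}\sqrt{\alpha^2-\beta^2}\right)\frac{f'(x^1)}{f(x^1)}.$$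
   Context: Finsler metrics here are non-regular: $F=F(x,y)$ is a function, positively homogeneous of degree $1$ in $y$, considered only on the conic open subset of $TM\setminus\{0\}$ where its defining expression is defined, smooth and nonzero (in particular $\alpha^2-\beta^2>0$), and whose metric tensor $g_{ij}=\frac12\frac{\partial^2F^2}{\partial y^i\partial y^j}$ is non-degenerate there; no definiteness is required (nor for the quadratic form $\alpha^2$). With $(g^{ij})$ the inverse of $(g_{ij})$, the geodesic spray of $F$ is $S=y^i\frac{\partial}{\partial x^i}-2G^i\frac{\partial}{\partial y^i}$ with coefficients $$G^i=\tfrac14 g^{ih}\left(y^r\frac{\partial^2F^2}{\partial x^r\partial y^h}-\frac{\partial F^2}{\partial x^h}\right).$$ The Berwald tensor is $G^h_{ijk}=\frac{\partial^3G^h}{\partial y^i\partial y^j\partial y^k}$ and the Landsberg tensor is $L_{ijk}=-\frac12F\,\ell_h\,G^h_{ijk}$, where $\ell_h=\frac{\partial F}{\partial y^h}$. $F$ is Landsberg if $L_{ijk}\equiv 0$ and Berwald (Berwaldian) if $G^h_{ijk}\equiv0$. Repeated indices are summed.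
   Formalization: The formal theorem adds the hypothesis that φ takes a positive value somewhere (c is not negative definite); otherwise α²−β² is never positive, F is defined nowhere, and ''not Berwaldian'' fails vacuously. *)

(* Defs.v *)
From mathcomp Require Import all_boot all_order all_algebra.
From mathcomp Require Import all_classical all_reals all_analysis.
Set Implicit Arguments.
Unset Strict Implicit.
Unset Printing Implicit Defensive.
Import Order.TTheory GRing.Theory Num.Theory.
Import numFieldNormedType.Exports.
Local Open Scope classical_set_scope.
Local Open Scope ring_scope.

(* The metrics live on an n-dimensional coordinate domain, n = m.+1. A point   *)
(* of the tangent bundle is a pair (x, y) of row vectors. The coordinate x^1   *)
(* is [x 0 ord0]; the coordinates x^2, ..., x^n are [x 0 (lift ord0 l)] for    *)
(* l : 'I_m. Likewise for y.                                                   *)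

Definition smooth_on (R : realType) (I : set R) (f : R -> R) : Prop :=
  forall (k : nat) (t : R), I t -> derivable (derive1n k f) t 1.

Definition partial_x (R : realType) (m : nat) (i : 'I_m.+1)
    (H : 'rV[R]_m.+1 -> 'rV[R]_m.+1 -> R) (x y : 'rV[R]_m.+1) : R :=
  'D_(delta_mx 0 i) (fun x' => H x' y) x.

Definition partial_y (R : realType) (m : nat) (i : 'I_m.+1)
    (H : 'rV[R]_m.+1 -> 'rV[R]_m.+1 -> R) (x y : 'rV[R]_m.+1) : R :=
  'D_(delta_mx 0 i) (H x) y.

Definition energy (R : realType) (m : nat)
    (F : 'rV[R]_m.+1 -> 'rV[R]_m.+1 -> R) (x y : 'rV[R]_m.+1) : R :=
  F x y ^+ 2.

Definition metric_tensor (R : realType) (m : nat)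
    (F : 'rV[R]_m.+1 -> 'rV[R]_m.+1 -> R) (x y : 'rV[R]_m.+1) : 'M[R]_m.+1 :=
  \matrix_(i, j) (2^-1 * partial_y i (partial_y j (energy F)) x y).

Definition spray_coef (R : realType) (m : nat)
    (F : 'rV[R]_m.+1 -> 'rV[R]_m.+1 -> R) (i : 'I_m.+1)
    (x y : 'rV[R]_m.+1) : R :=
  4^-1 * \sum_h invmx (metric_tensor F x y) i h *
    ((\sum_r y 0 r * partial_x r (partial_y h (energy F)) x y)
     - partial_x h (energy F) x y).

Definition berwald_tensor (R : realType) (m : nat)
    (F : 'rV[R]_m.+1 -> 'rV[R]_m.+1 -> R) (h i j k : 'I_m.+1)
    (x y : 'rV[R]_m.+1) : R :=
  partial_y i (partial_y j (partial_y k (spray_coef F h))) x y.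

Definition landsberg_tensor (R : realType) (m : nat)
    (F : 'rV[R]_m.+1 -> 'rV[R]_m.+1 -> R) (i j k : 'I_m.+1)
    (x y : 'rV[R]_m.+1) : R :=
  - 2^-1 * F x y *
    \sum_h partial_y h F x y * berwald_tensor F h i j k x y.

Definition is_landsberg (R : realType) (m : nat)
    (D : set ('rV[R]_m.+1 * 'rV[R]_m.+1))
    (F : 'rV[R]_m.+1 -> 'rV[R]_m.+1 -> R) : Prop :=
  forall x y, D (x, y) -> forall i j k, landsberg_tensor F i j k x y = 0.

Definition is_berwald (R : realType) (m : nat)
    (D : set ('rV[R]_m.+1 * 'rV[R]_m.+1))
    (F : 'rV[R]_m.+1 -> 'rV[R]_m.+1 -> R) : Prop :=
  forall x y, D (x, y) -> forall h i j k, berwald_tensor F h i j k x y = 0.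

Definition phi (R : realType) (m : nat) (c : 'M[R]_m) (y : 'rV[R]_m.+1) : R :=
  \sum_l \sum_k c l k * y 0 (lift ord0 l) * y 0 (lift ord0 k).

Definition beta (R : realType) (m : nat) (f : R -> R)
    (x y : 'rV[R]_m.+1) : R :=
  f (x 0 ord0) * y 0 ord0.

Definition alpha (R : realType) (m : nat) (f : R -> R) (c : 'M[R]_m)
    (x y : 'rV[R]_m.+1) : R :=
  f (x 0 ord0) * Num.sqrt (y 0 ord0 ^+ 2 + phi c y).

Definition finsler (R : realType) (m : nat) (f : R -> R) (c : 'M[R]_m) (a : R)
    (x y : 'rV[R]_m.+1) : R :=
  let b := beta f x y in
  let q := Num.sqrt (alpha f c x y ^+ 2 - beta f x y ^+ 2) in
  (a * b + q) * expR (a * b / (a * b + q)).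

(* The conic domain over U on which the metric is considered. For f > 0 the    *)
(* inequality amounts to 0 < phi c y; it forces y != 0 and, [Num.sqrt] being 0 *)
(* on negative arguments, also a positive radicand in alpha. Together with the *)
(* condition a * beta + sqrt (alpha^2 - beta^2) != 0 it says that F is         *)
(* defined, smooth and nonzero. The domain is empty when phi takes no positive *)
(* value (e.g. for c negative definite).                                       *)
Definition finsler_domain (R : realType) (m : nat) (U : set 'rV[R]_m.+1)
    (f : R -> R) (c : 'M[R]_m) (a : R) : set ('rV[R]_m.+1 * 'rV[R]_m.+1) :=
  [set z | [/\ U z.1,
     0 < alpha f c z.1 z.2 ^+ 2 - beta f z.1 z.2 ^+ 2,
     a * beta f z.1 z.2
       + Num.sqrt (alpha f c z.1 z.2 ^+ 2 - beta f z.1 z.2 ^+ 2) != 0 &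
     metric_tensor (finsler f c a) z.1 z.2 \in unitmx]].

(* Main.v *)
Require Import Defs.
From mathcomp Require Import all_boot all_order all_algebra.
From mathcomp Require Import all_classical all_reals all_analysis.
From mathcomp Require Import ring.
Import Order.TTheory GRing.Theory Num.Theory.
Import numFieldNormedType.Exports.
Local Open Scope classical_set_scope.
Local Open Scope ring_scope.

(**
Write s = y^1, u = sqrt phi and w = a s + u. Since alpha^2 - beta^2 = f^2 phi,
the metric is F = f(x^1) N(y) with N = w exp(a s / w): it is conformal, with a
factor depending on x^1 only, to the Minkowski norm N. Hence g = f^2 h, where h
is half the Hessian of N^2, and the spray equation becomes the linear system
<<
    h G = (f'/2f) (s d(N^2) - N^2 dy^1).
>>
Directional derivatives in arbitrary directions v keep this coordinate-free:
with B the polar form of phi,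
<<
    d(N^2)(v) = exp(a s / w)^2 ((4 a u + 2 a^2 s) v^1 + 2 B(y, v)),
>>
an expression so simple that the Hessian is explicit ([hess_sq_profile]) and
two facts can be read off it.

- It is non-degenerate wherever phi > 0 and w <> 0: testing a kernel vector v
  against y and against the first basis vector yields B(y, v) = 0 and v^1 = 0,
  after which only B(., v) = 0 is left ([hess_sq_profile_nondegenerate]). So the
  domain of F is U times the open cone {phi > 0, w <> 0}, and formulas valid on
  it may be differentiated.
- The solution of the linear system is G = (f'/f) T, where
  T = p y - (p^2/2) e_1 and p = s + u/a ([hess_spray_dir], [spray_coefE]).
  This is the announced spray.

The component T^1 = s^2/2 - phi/(2 a^2) is quadratic in y, so it does not
contribute to the Berwald tensor. For the other components only u y^mu / a has
third derivatives, namely those collected in the vector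
<<
    Z(v, z, t) = (u_vzt y + u_vz t + u_vt z + u_zt v) / a.
>>
Landsberg: along these components dF is proportional to B(y, .), and
B(y, Z(v, z, t)) = u (u^2)_vzt / (2 a) = 0 because u^2 = phi is quadratic
([cform_d3spray]).

Not Berwald: u_vzt has degree -2 in y, so Euler's relation gives that the trace
of Z(v, z, .) over y^2, ..., y^n is (n / a) u_vz ([trace_d3spray]). If it
vanished, so would the Hessian of u on the basis vectors; as
u u_vz = B(v, z) - u_v u_z, the matrix c would have rank at most one, whereas
it is invertible of size n - 1 >= 2 ([d2rho_neq0]).
*)

Set Implicit Arguments.
Unset Strict Implicit.
Unset Printing Implicit Defensive.

(** * Directional derivatives of scalar functions *)

Section DirectionalDerivatives.
Context {R : realType}.

(** The class [is_derive] under another name: since instance resolution ignores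
    it, the rules below are applied one by one and produce derivatives stated
    with the multiplication of [R] instead of its scaling operation. *)
Definition has_derive {V : normedModType R} (y v : V) (g : V -> R)
  (d : R) : Prop := is_derive y v g d.

Context {V : normedModType R}.
Implicit Types (g h : V -> R) (y v : V).

(** A directional derivative is an ordinary derivative at 0; this transfers the
    one-variable chain rule to functions of several variables. *)
Lemma has_derive_along_line g y v d :
  has_derive y v g d <-> has_derive (0 : R) 1 (fun t : R => g (t *: v + y)) d.
Proof.
have E : 'D_v g y = 'D_1 (fun t : R => g (t *: v + y)) 0.
  apply: (congr1 (fun k : R -> R => lim (k @ 0^'))); apply/funext => t /=.
  by rewrite addr0 [t *: 1]mulr1 scale0r add0r.
split=> -[gy <-]; apply: DeriveDef => //.
- by move/derivable1P : gy.
- by apply/derivable1P.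
Qed.

Lemma has_derive_eq g y v d d' :
  has_derive y v g d -> d = d' -> has_derive y v g d'.
Proof. by move=> ? <-. Qed.

Lemma has_derive_comp (k : R -> R) g y v a b :
  has_derive (g y) 1 k a -> has_derive y v g b ->
  has_derive y v (fun z => k (g z)) (a * b).
Proof.
move=> kd /has_derive_along_line gd; apply/has_derive_along_line.
have E : g (0 *: v + y) = g y by rewrite scale0r add0r.
by apply: (@is_derive1_comp _ k (fun t : R => g (t *: v + y))); rewrite ?E.
Qed.

Lemma has_derive_cst (k : R) y v : has_derive y v (fun=> k) 0.
Proof. exact: is_derive_cst. Qed.

Lemma has_deriveD g h y v dg dh :
  has_derive y v g dg -> has_derive y v h dh ->
  has_derive y v (fun z => g z + h z) (dg + dh).
Proof. by move=> gd hd; exact: is_deriveD. Qed.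

Lemma has_deriveN g y v dg :
  has_derive y v g dg -> has_derive y v (fun z => - g z) (- dg).
Proof. by move=> gd; exact: is_deriveN. Qed.

Lemma has_deriveM g h y v dg dh :
  has_derive y v g dg -> has_derive y v h dh ->
  has_derive y v (fun z => g z * h z) (g y * dh + h y * dg).
Proof. by move=> gd hd; exact: is_deriveM. Qed.

Lemma has_deriveX g (n : nat) y v dg :
  has_derive y v g dg ->
  has_derive y v (fun z => g z ^+ n) (n%:R * g y ^+ n.-1 * dg).
Proof.
move=> gd; have -> : (fun z => g z ^+ n) = g ^+ n.
  by apply/funext => z; rewrite fctE.
exact: is_deriveX.
Qed.

Lemma has_deriveV g y v dg : g y != 0 -> has_derive y v g dg ->
  has_derive y v (fun z => (g z)^-1) (- (g y) ^- 2 * dg).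
Proof.
move=> gy0 [gd <-]; apply: DeriveDef; first exact: derivableV.
by rewrite deriveV.
Qed.

(** Derivatives only see germs: iterating this on a fixed open set computes
    higher derivatives of a function known by a formula on that set only. *)
Lemma derive_eq_on_open (O : set V) g h y v d : open O ->
  (forall z, O z -> h z = g z) -> O y -> has_derive y v g d -> 'D_v h y = d.
Proof.
move=> Oo gh Oy [_ <-]; apply: near_eq_derive; near=> z; apply: gh.
by near: z; exact: open_nbhs_nbhs.
Unshelve. all: by end_near. Qed.

Lemma has_derive_id (t : R) : has_derive t 1 (fun r => r) 1.
Proof. exact: is_derive_id. Qed.

End DirectionalDerivatives.

Ltac derive_step := first
  [ exact: has_derive_cst | exact: has_derive_id | eassumption
  | apply: has_deriveD | apply: has_deriveN | apply: has_deriveM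
  | apply: has_deriveX | apply: has_deriveV ].

(** * Linear functionals on row vectors *)

Section LinearFunctionals.
Context {R : realType} {m : nat}.
Variable L : 'rV[R]_m.+1 -> R.
Implicit Types v : 'rV[R]_m.+1.
Hypothesis L_linear : forall k (y z : 'rV[R]_m.+1),
  L (k *: y + z) = k * L y + L z.

Lemma sum_linear v : \sum_j L (delta_mx 0 j) * v 0 j = L v.
Proof.
have L0 : L 0 = 0.
  by have := L_linear (-1) 0 0; rewrite scaler0 addr0 mulN1r addNr.
rewrite [in RHS](row_sum_delta v); symmetry.
by elim/big_rec2 : _ => [//|j r y _ <-]; rewrite L_linear mulrC.
Qed.

Lemma sum_linear_tail v : L (delta_mx 0 ord0) = 0 ->
  \sum_l L (delta_mx 0 (lift ord0 l)) * v 0 (lift ord0 l) = L v.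
Proof. by move=> L0; rewrite -(sum_linear v) big_ord_recl L0 mul0r add0r. Qed.

End LinearFunctionals.

(** * The polar form of phi *)

Section Form.
Context {R : realType} {m : nat} (c : 'M[R]_m).
Implicit Types y v z : 'rV[R]_m.+1.

Definition cform y v : R :=
  \sum_l \sum_k c l k * y 0 (lift ord0 l) * v 0 (lift ord0 k).

Lemma cformDl y v z : cform (y + v) z = cform y z + cform v z.
Proof.
rewrite -big_split; apply: eq_bigr => l _ /=; rewrite -big_split.
by apply: eq_bigr => k _ /=; rewrite mxE mulrDr mulrDl.
Qed.

Lemma cformZl k y z : cform (k *: y) z = k * cform y z.
Proof.
rewrite mulr_sumr; apply: eq_bigr => l _; rewrite mulr_sumr.
by apply: eq_bigr => j _; rewrite mxE; ring.
Qed.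

Lemma cformE y v :
  cform y v = \sum_k (\sum_l c l k * y 0 (lift ord0 l)) * v 0 (lift ord0 k).
Proof.
by rewrite /cform exchange_big; apply: eq_bigr => k _ /=; rewrite mulr_suml.
Qed.

Hypothesis c_sym : c^T = c.

Lemma cformC y v : cform y v = cform v y.
Proof.
rewrite /cform exchange_big; apply: eq_bigr => k _; apply: eq_bigr => l _ /=.
by rewrite -[in LHS]c_sym mxE; ring.
Qed.

Lemma cformDr y v z : cform z (y + v) = cform z y + cform z v.
Proof. by rewrite !(cformC z) cformDl. Qed.

Lemma cformZr k y z : cform z (k *: y) = k * cform z y.
Proof. by rewrite !(cformC z) cformZl. Qed.

Lemma cform_linear y k v z : cform y (k *: v + z) = k * cform y v + cform y z.
Proof. by rewrite cformDr cformZr. Qed.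

Lemma cform_delta y k :
  cform y (delta_mx 0 (lift ord0 k)) = \sum_l c l k * y 0 (lift ord0 l).
Proof.
rewrite cformE (bigD1 k)//= mxE !eqxx mulr1 [X in _ + X]big1 ?addr0// => j jk.
by rewrite mxE /= (inj_eq lift_inj) (negbTE jk) mulr0.
Qed.

Lemma cform_delta0 y : cform y (delta_mx 0 ord0) = 0.
Proof.
by rewrite cformE big1// => k _; rewrite mxE/= mulr0.
Qed.

Lemma cform_delta_delta k l :
  cform (delta_mx 0 (lift ord0 k)) (delta_mx 0 (lift ord0 l)) = c k l.
Proof.
rewrite cform_delta (bigD1 k)//= mxE !eqxx mulr1 big1 ?addr0// => j jk.
by rewrite mxE /= (inj_eq lift_inj) (negbTE jk) mulr0.
Qed.

Lemma sum_cform_delta y v :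
  \sum_k cform y (delta_mx 0 (lift ord0 k)) * v 0 (lift ord0 k) = cform y v.
Proof. by rewrite cformE; apply: eq_bigr => k _; rewrite cform_delta. Qed.

(** The form ignores the first coordinate, and its radical is no larger. *)
Lemma cform_nondegenerate v : c \in unitmx ->
  (forall y, cform y v = 0) -> forall k, v 0 (lift ord0 k) = 0.
Proof.
move=> cU cv k.
have : (\row_l v 0 (lift ord0 l)) *m c = 0.
  apply/rowP => l; rewrite !mxE -[RHS](cv (delta_mx 0 (lift ord0 l))) cformC.
  by rewrite cform_delta; apply: eq_bigr => j _; rewrite mxE mulrC.
move/(congr1 (mulmx^~ (invmx c))); rewrite mulmxK// mul0mx => /rowP/(_ k).
by rewrite !mxE.
Qed.

Lemma has_derive_coord i y v : has_derive y v (fun z => z 0 i) (v 0 i).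
Proof.
apply/has_derive_along_line.
have -> : (fun t : R => (t *: v + y) 0 i) = (fun t => t * v 0 i + y 0 i).
  by apply/funext => t; rewrite !mxE.
apply: has_derive_eq; first by repeat derive_step.
by rewrite mulr0 add0r addr0 mulr1.
Qed.

Lemma has_derive_cform z y v : has_derive y v (fun w => cform w z) (cform v z).
Proof.
apply/has_derive_along_line.
have -> : (fun t : R => cform (t *: v + y) z)
          = (fun t => t * cform v z + cform y z).
  by apply/funext => t; rewrite cformDl cformZl.
apply: has_derive_eq; first by repeat derive_step.
by rewrite mulr0 add0r addr0 mulr1.
Qed.

Lemma has_derive_phi y v : has_derive y v (phi c) (2 * cform y v).
Proof.
apply/has_derive_along_line.
have -> : (fun t : R => phi c (t *: v + y))
    = (fun t => t ^+ 2 * cform v v + (t * (2 * cform y v) + cform y y)).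
  apply/funext => t; rewrite -[LHS]/(cform _ _) cformDl !cformDr !cformZl.
  by rewrite !cformZr (cformC v y); ring.
apply: has_derive_eq; first by repeat derive_step.
rewrite /=; ring.
Qed.

Lemma continuous_phi : continuous (phi c).
Proof.
apply: continuous_big => [|l _]; first exact: add_continuous.
apply: continuous_big => [|k _]; first exact: add_continuous.
have cont_coord j : continuous (fun y : 'rV[R]_m.+1 => y 0 j).
  by move=> y; exact: coord_continuous.
move=> y; exact: (continuousM
  (continuousM (@cst_continuous _ _ (c l k) y) (@cont_coord (lift ord0 l) y))
  (@cont_coord (lift ord0 k) y)).
Qed.

End Form.

Ltac form_derive_step := first
  [ derive_step | exact: has_derive_coord | exact: has_derive_cform ].

(** * The Minkowski norm underlying the metric *)

Section Profile.
Context {R : realType} {m : nat} (c : 'M[R]_m) (a : R).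
Hypothesis c_sym : c^T = c.
Hypothesis a_neq0 : a != 0.
Implicit Types y v z t : 'rV[R]_m.+1.
Local Notation hd y := (y 0 ord0).
Local Notation B := (cform c).

(** [rho], [width] and [profile] are the functions u, w and N of the
    introduction; [cone] is the set of the y where F is smooth and nonzero. *)
Definition rho y : R := Num.sqrt (phi c y).
Definition width y : R := a * hd y + rho y.
Definition weight y : R := expR (a * hd y / width y).
Definition profile y : R := width y * weight y.

Definition cone : set 'rV[R]_m.+1 := [set y | 0 < phi c y /\ width y != 0].

Lemma rho_gt0 y : 0 < phi c y -> 0 < rho y.
Proof. by rewrite /rho sqrtr_gt0. Qed.

Lemma rho_neq0 y : 0 < phi c y -> rho y != 0.
Proof. by move/rho_gt0; rewrite lt0r => /andP[]. Qed.

Lemma sqr_rho y : 0 < phi c y -> rho y ^+ 2 = phi c y.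
Proof. by move=> /ltW; exact: sqr_sqrtr. Qed.

Lemma cform_self y : 0 < phi c y -> B y y = rho y ^+ 2.
Proof. by move/sqr_rho ->. Qed.

Lemma continuous_width : continuous width.
Proof.
have cont_rho : continuous rho.
  move=> y; apply: (@continuous_comp _ _ _ (phi c) Num.sqrt y).
    exact: continuous_phi.
  exact: sqrt_continuous.
have cont_y1 : continuous (fun y => hd y) by move=> y; exact: coord_continuous.
move=> y; exact: (continuousD
  (continuousM (@cst_continuous _ _ a y) (cont_y1 y)) (cont_rho y)).
Qed.

Lemma open_cone : open cone.
Proof.
apply: openI.
- apply: (@open_comp _ _ (phi c) [set r | 0 < r]); last exact: open_gt.
  by move=> y _; exact: continuous_phi.
- apply: (@open_comp _ _ width [set r | r != 0]); last exact: open_neq.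
  by move=> y _; exact: continuous_width.
Qed.

Lemma has_derive_rho y v : 0 < phi c y -> has_derive y v rho (B y v / rho y).
Proof.
move=> phi_gt0; have u0 := rho_neq0 phi_gt0.
apply: has_derive_eq.
  apply: (has_derive_comp (k := Num.sqrt)); last exact: has_derive_phi.
  exact: is_derive1_sqrt.
rewrite -/(rho y); field.
by rewrite u0.
Qed.

Lemma has_derive_width y v : 0 < phi c y ->
  has_derive y v width (a * hd v + B y v / rho y).
Proof.
move=> phi_gt0; have du := has_derive_rho v phi_gt0.
apply: has_derive_eq; first by repeat form_derive_step.
by rewrite mulr0 addr0.
Qed.

Lemma has_derive_weight y v : cone y ->
  has_derive y v weight
    (weight y * (a * (rho y ^+ 2 * hd v - hd y * B y v)
                 / (rho y * width y ^+ 2))).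
Proof.
move=> [phi_gt0 w0]; have u0 := rho_neq0 phi_gt0.
have dw := has_derive_width v phi_gt0.
apply: has_derive_comp; [exact: is_derive_expR|].
apply: has_derive_eq; first by repeat form_derive_step.
move: w0; rewrite /width => w0; field.
by rewrite u0 w0.
Qed.

Lemma has_derive_profile y v : cone y ->
  has_derive y v profile
    (weight y * (a * (a * hd y + 2 * rho y) * hd v + B y v) / width y).
Proof.
move=> Cy; have [phi_gt0 w0] := Cy; have u0 := rho_neq0 phi_gt0.
have dw := has_derive_width v phi_gt0; have de := has_derive_weight v Cy.
apply: has_derive_eq; first by repeat form_derive_step.
move: w0; rewrite /width => w0; field.
by rewrite u0 w0.
Qed.

(** The differential of N^2. Differentiating w and exp(a s / w) separately would
    leave powers of w in the denominators; in N^2 they cancel. *)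
Definition dsq_profile y v : R :=
  weight y ^+ 2 * ((4 * a * rho y + 2 * a ^+ 2 * hd y) * hd v + 2 * B y v).

Lemma has_derive_sq_profile y v : cone y ->
  has_derive y v (fun z => profile z ^+ 2) (dsq_profile y v).
Proof.
move=> Cy; have [phi_gt0 w0] := Cy.
apply: has_derive_eq.
  by apply: has_deriveX; exact: has_derive_profile.
by rewrite /dsq_profile /profile; field.
Qed.

(** The Hessian of N^2. The first summand comes from the derivative of the
    exponential and repeats the bracket of [dsq_profile]. *)
Definition hess_sq_profile y z v : R :=
  weight y ^+ 2 *
   (2 * a * (rho y ^+ 2 * hd z - hd y * B y z) / (rho y * width y ^+ 2)
      * ((4 * a * rho y + 2 * a ^+ 2 * hd y) * hd v + 2 * B y v)
    + (4 * a * (B y z / rho y) + 2 * a ^+ 2 * hd z) * hd v + 2 * B z v).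

Lemma has_derive_dsq_profile y z v : cone y ->
  has_derive y z (fun y => dsq_profile y v) (hess_sq_profile y z v).
Proof.
move=> Cy; have [phi_gt0 w0] := Cy; have u0 := rho_neq0 phi_gt0.
have du := has_derive_rho z phi_gt0; have de := has_derive_weight z Cy.
apply: has_derive_eq; first by repeat form_derive_step.
rewrite /hess_sq_profile; field.
by rewrite u0 w0.
Qed.

(** Since N^2 is homogeneous of degree 2, the Hessian applied to (y, v) is the
    differential at v; this makes the bracket q vanish and with it the first
    summand of the Hessian against every z. The direction e_1, which is in the
    radical of B, then isolates v^1, and what remains is B(z, v). *)
Lemma hess_sq_profile_nondegenerate y v : c \in unitmx -> cone y ->
  (forall z, hess_sq_profile y z v = 0) -> v = 0.
Proof.
move=> cU [phi_gt0 w0] hv; have u0 := rho_neq0 phi_gt0.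
have e0 : weight y ^+ 2 != 0 by rewrite expf_neq0// gt_eqF// expR_gt0.
set q := (4 * a * rho y + 2 * a ^+ 2 * hd y) * hd v + 2 * B y v.
have q0 : q = 0.
  have := hv y; rewrite /hess_sq_profile (cform_self phi_gt0) -/q => /eqP.
  rewrite mulf_eq0 (negbTE e0) /= => /eqP <-.
  by rewrite /q; field; rewrite u0 w0.
have v1 : hd v = 0.
  have := hv (delta_mx 0 ord0); rewrite /hess_sq_profile -/q q0 => /eqP.
  rewrite mulf_eq0 (negbTE e0) /= cform_delta0 (cformC c_sym _ v).
  rewrite cform_delta0 mxE !eqxx mulr0 mul0r !mulr0 !add0r !addr0 mulr1.
  rewrite mulf_eq0 mulf_eq0 pnatr_eq0 /= expf_eq0 /= (negbTE a_neq0) /=.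
  by move/eqP.
apply/rowP => i; rewrite [RHS]mxE; case: (unliftP ord0 i) => [k ->|-> //].
apply: (cform_nondegenerate c_sym cU) => z.
have /eqP := hv z; rewrite /hess_sq_profile -/q q0 v1 !mulr0 !add0r.
by rewrite mulf_eq0 (negbTE e0) mulf_eq0 pnatr_eq0 /= => /eqP.
Qed.

Definition slope y : R := hd y + rho y / a.

(** The spray of F divided by f'/f: the vector p y - (p^2/2) e_1, where p is
    [slope y]. *)
Definition spray_dir y : 'rV[R]_m.+1 :=
  slope y *: y + (- (slope y ^+ 2 / 2)) *: delta_mx 0 ord0.

Lemma spray_dir1 y :
  hd (spray_dir y) = slope y * hd y - slope y ^+ 2 / 2.
Proof. by rewrite !mxE !eqxx mulr1. Qed.

Lemma spray_dir_lift y k :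
  spray_dir y 0 (lift ord0 k) = slope y * y 0 (lift ord0 k).
Proof. by rewrite !mxE /= mulr0 addr0. Qed.

Lemma cform_spray_dir z y : B z (spray_dir y) = slope y * B z y.
Proof.
by rewrite (cformDr c_sym) !(cformZr c_sym) cform_delta0 mulr0 addr0.
Qed.

(** The linear system satisfied by the spray. As B(z, T) = p B(z, y), both sides
    are rational functions of s, u, z^1 and B(y, z), up to the common factor
    exp(a s / w)^2. *)
Lemma hess_spray_dir y z : cone y ->
  hess_sq_profile y z (spray_dir y)
  = hd y * dsq_profile y z - hd z * profile y ^+ 2.
Proof.
move=> [phi_gt0 w0]; have u0 := rho_neq0 phi_gt0.
rewrite /hess_sq_profile /dsq_profile /profile !cform_spray_dir spray_dir1.
rewrite (cform_self phi_gt0) (cformC c_sym z y) /slope.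
move: w0; rewrite /width => w0; field.
by rewrite a_neq0 u0 w0.
Qed.

End Profile.

(** * Third derivatives of the spray *)

Section Spray.
Context {R : realType} {m : nat} (c : 'M[R]_m) (a : R).
Hypothesis c_sym : c^T = c.
Hypothesis a_neq0 : a != 0.
Implicit Types (y v z t : 'rV[R]_m.+1).
Local Notation hd y := (y 0 ord0).
Local Notation B := (cform c).
Local Notation rho := (rho c).
Local Notation cone := (cone c a).

Lemma hess_sq_profile_linear y z k v t :
  hess_sq_profile c a y z (k *: v + t)
  = k * hess_sq_profile c a y z v + hess_sq_profile c a y z t.
Proof. by rewrite /hess_sq_profile !(cform_linear c_sym) !mxE; ring. Qed.

Definition drho y v : R := B y v / rho y.
Definition d2rho y v z : R := (B v z - drho y v * drho y z) / rho y.
(** This form of the third derivative comes from differentiating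
    rho rho_vz = B(v, z) - rho_v rho_z. *)
Definition d3rho y v z t : R :=
  - (d2rho y v z * drho y t + d2rho y v t * drho y z + d2rho y z t * drho y v)
  / rho y.

Lemma has_derive_drho y v z : 0 < phi c y ->
  has_derive y v (fun y => drho y z) (d2rho y v z).
Proof.
move=> phi_gt0; have u0 := rho_neq0 phi_gt0.
have du := has_derive_rho c_sym v phi_gt0.
rewrite /drho; apply: has_derive_eq; first by repeat form_derive_step.
by rewrite /d2rho /drho; field.
Qed.

Lemma has_derive_d2rho y v z t : 0 < phi c y ->
  has_derive y v (fun y => d2rho y z t) (d3rho y v z t).
Proof.
move=> phi_gt0; have u0 := rho_neq0 phi_gt0.
have du := has_derive_rho c_sym v phi_gt0.
have dz := has_derive_drho v z phi_gt0; have dt := has_derive_drho v t phi_gt0.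
rewrite {1}/d2rho; apply: has_derive_eq; first by repeat form_derive_step.
by rewrite /d3rho /d2rho /drho; field.
Qed.

Lemma drho_self y : 0 < phi c y -> drho y y = rho y.
Proof.
move=> phi_gt0; rewrite /drho cform_self// expr2 mulfK//.
exact: rho_neq0.
Qed.

(** This and the next lemma are Euler's relations for the differential of rho,
    of degree 0, and for its Hessian, of degree -1. *)
Lemma d2rho_self y v : 0 < phi c y -> d2rho y v y = 0.
Proof.
move=> phi_gt0; rewrite /d2rho drho_self// /drho divfK ?rho_neq0//.
by rewrite (cformC c_sym) subrr mul0r.
Qed.

Lemma d3rho_self y v z : 0 < phi c y -> d3rho y v z y = - d2rho y v z.
Proof.
move=> phi_gt0; have u0 := rho_neq0 phi_gt0.
by rewrite /d3rho !d2rho_self// drho_self//; field.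
Qed.

(** The third derivatives of the vector field rho y / a. *)
Definition d3spray y v z t : 'rV[R]_m.+1 :=
  a^-1 *: (d3rho y v z t *: y + d2rho y v z *: t + d2rho y v t *: z
           + d2rho y z t *: v).

(** As B(y, v) = rho rho_v, this is rho/a times
    rho rho_vzt + rho_vz rho_t + rho_vt rho_z + rho_zt rho_v, that is, half the
    third derivative of the quadratic function rho^2. *)
Lemma cform_d3spray y v z t : 0 < phi c y -> B y (d3spray y v z t) = 0.
Proof.
move=> phi_gt0; have u0 := rho_neq0 phi_gt0.
rewrite /d3spray (cformZr c_sym) !(cformDr c_sym) !(cformZr c_sym).
rewrite (cform_self phi_gt0) /d3rho /drho; field.
by rewrite u0 a_neq0.
Qed.

(** The four terms of [d3spray] contribute -1 (by Euler's relation), m, 1 and 1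
    times rho_vz. *)
Lemma trace_d3spray y v z : 0 < phi c y ->
  \sum_l d3spray y v z (delta_mx 0 (lift ord0 l)) 0 (lift ord0 l)
  = a^-1 * m.+1%:R * d2rho y v z.
Proof.
move=> phi_gt0.
have drho_lin k p q : drho y (k *: p + q) = k * drho y p + drho y q.
  by rewrite /drho (cform_linear c_sym); ring.
have d2_lin w k p q : d2rho y w (k *: p + q) = k * d2rho y w p + d2rho y w q.
  by rewrite /d2rho (cform_linear c_sym) drho_lin; ring.
have d3_lin k p q :
    d3rho y v z (k *: p + q) = k * d3rho y v z p + d3rho y v z q.
  by rewrite /d3rho !d2_lin drho_lin; ring.
have drho0 : drho y (delta_mx 0 ord0) = 0 by rewrite /drho cform_delta0 mul0r.
have d20 w : d2rho y w (delta_mx 0 ord0) = 0.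
  by rewrite /d2rho cform_delta0 drho0 mulr0 subrr mul0r.
have d30 : d3rho y v z (delta_mx 0 ord0) = 0.
  by rewrite /d3rho !d20 drho0 mulr0 !mul0r !addr0 oppr0 mul0r.
pose e l : 'rV[R]_m.+1 := delta_mx 0 (lift ord0 l).
transitivity (a^-1 * (\sum_l d3rho y v z (e l) * y 0 (lift ord0 l)
   + \sum_(l < m) d2rho y v z
   + \sum_l d2rho y v (e l) * z 0 (lift ord0 l)
   + \sum_l d2rho y z (e l) * v 0 (lift ord0 l))).
  rewrite -!big_split mulr_sumr; apply: eq_bigr => l _.
  by rewrite !mxE !eqxx /= mulr1.
rewrite !sum_linear_tail// d3rho_self// sumr_const card_ord.
have -> : d2rho y z v = d2rho y v z.
  by rewrite /d2rho (cformC c_sym) [drho _ _ * _]mulrC.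
by rewrite -[in LHS]mulr_natr -[m.+1%:R]natr1; ring.
Qed.

(** Otherwise c would be the product of a column and a row. *)
Lemma d2rho_neq0 y : (1 < m)%N -> c \in unitmx -> 0 < phi c y ->
  ~ forall k l,
    d2rho y (delta_mx 0 (lift ord0 k)) (delta_mx 0 (lift ord0 l)) = 0.
Proof.
move=> m_gt1 cU phi_gt0 d2_0; have u0 := rho_neq0 phi_gt0.
pose p : 'rV[R]_m := \row_k drho y (delta_mx 0 (lift ord0 k)).
have cE : c = p^T *m p.
  apply/matrixP => k l; rewrite mxE big_ord1 !mxE -[c k l]cform_delta_delta.
  move/eqP: (d2_0 k l); rewrite /d2rho mulf_eq0 invr_eq0 (negbTE u0) orbF.
  by rewrite subr_eq0 => /eqP.
have := leq_trans (mxrankM_maxr p^T p) (rank_leq_row p).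
by rewrite -cE mxrank_unit// leqNgt m_gt1.
Qed.

(** The function g will be a spray coefficient at a fixed x, for which the
    formula is available on the cone only. *)
Lemma third_derive_spray_dir (h : 'I_m.+1) y v z t (g : 'rV[R]_m.+1 -> R) k :
  (forall y, cone y -> g y = k * spray_dir c a y 0 h) -> cone y ->
  'D_v (fun y => 'D_z (fun y => 'D_t g y) y) y
  = if h == ord0 then 0 else k * d3spray y v z t 0 h.
Proof.
have Oo := @open_cone _ _ c a.
move=> gE Cy; case: (unliftP ord0 h) gE => [l ->|->] gE.
- pose T2 y := k * (a^-1 * d2rho y z t * y 0 (lift ord0 l)
      + (hd t + drho y t / a) * z 0 (lift ord0 l)
      + (hd z + drho y z / a) * t 0 (lift ord0 l)).
  pose T1 y := k * ((hd t + drho y t / a) * y 0 (lift ord0 l)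
      + (hd y + rho y / a) * t 0 (lift ord0 l)).
  have d1 q : cone q -> 'D_t g q = T1 q.
    move=> Cq; have [phi_gt0 _] := Cq; have u0 := rho_neq0 phi_gt0.
    have du := has_derive_rho c_sym t phi_gt0.
    pose T0 y := k * ((hd y + rho y / a) * y 0 (lift ord0 l)).
    apply: (derive_eq_on_open (g := T0) Oo) => //; rewrite /T0.
      by move=> s Cs; rewrite gE// spray_dir_lift.
    apply: has_derive_eq; first by repeat form_derive_step.
    by rewrite /T1 /drho; field; rewrite u0 a_neq0.
  have d2 q : cone q -> 'D_z (fun y => 'D_t g y) q = T2 q.
    move=> Cq; have [phi_gt0 _] := Cq; have u0 := rho_neq0 phi_gt0.
    have du := has_derive_rho c_sym z phi_gt0.
    have dr := has_derive_drho z t phi_gt0.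
    apply: (derive_eq_on_open Oo d1 Cq); rewrite /T1.
    apply: has_derive_eq; first by repeat form_derive_step.
    by rewrite /T2 /drho; field; rewrite u0 a_neq0.
  have [phi_gt0 _] := Cy; have u0 := rho_neq0 phi_gt0.
  have du := has_derive_rho c_sym v phi_gt0.
  have drt := has_derive_drho v t phi_gt0.
  have drz := has_derive_drho v z phi_gt0.
  have dr2 := has_derive_d2rho v z t phi_gt0.
  apply: (derive_eq_on_open Oo d2 Cy); rewrite /T2.
  apply: has_derive_eq; first by repeat form_derive_step.
  by rewrite !mxE/=; field.
- rewrite eqxx.
  (* The square in p^2/2 removes the product s u from p s, so that this
     component is a quadratic polynomial, with constant second derivatives. *)
  pose T2 (y : 'rV[R]_m.+1) := k * (hd t * hd z - B z t / a ^+ 2).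
  pose T1 (y : 'rV[R]_m.+1) := k * (hd t * hd y - B y t / a ^+ 2).
  have d1 q : cone q -> 'D_t g q = T1 q.
    move=> Cq; have [phi_gt0 _] := Cq.
    have dp := has_derive_phi c_sym q t.
    pose T0 y := k * (hd y ^+ 2 / 2 - phi c y / (2 * a ^+ 2)).
    apply: (derive_eq_on_open (g := T0) Oo) => //; rewrite /T0.
      move=> s Cs; have [phi_gt0' _] := Cs.
      by rewrite gE// spray_dir1 /slope -sqr_rho//; field.
    apply: has_derive_eq; first by repeat form_derive_step.
    by rewrite /T1; field.
  have d2 q : cone q -> 'D_z (fun y => 'D_t g y) q = T2 q.
    move=> Cq; apply: (derive_eq_on_open Oo d1 Cq); rewrite /T1.
    apply: has_derive_eq; first by repeat form_derive_step.
    by rewrite /T2; field.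
  by apply: (derive_eq_on_open Oo d2 Cy); exact: has_derive_cst.
Qed.

End Spray.

(** * The Finsler metric and its spray *)

Section Finsler.
Context {R : realType} {m : nat} (U : set 'rV[R]_m.+1) (f : R -> R).
Context (c : 'M[R]_m) (a : R).
Hypothesis U_open : open U.
Hypothesis f_derivable : forall x, U x -> derivable f (x 0 ord0) 1.
Hypothesis f_pos : forall x, U x -> 0 < f (x 0 ord0).
Hypothesis c_sym : c^T = c.
Hypothesis c_unit : c \in unitmx.
Hypothesis a_neq0 : a != 0.
Implicit Types (x y v z : 'rV[R]_m.+1).
Local Notation hd y := (y 0 ord0).
Local Notation e i := (delta_mx 0 i : 'rV[R]_m.+1).
Local Notation cone := (cone c a).
Local Notation F := (finsler f c a).
Local Notation D := (finsler_domain U f c a).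
Local Notation tau x := (derive1 f (hd x) / f (hd x)).

Lemma sqr_alpha_sub_beta x y : 0 < phi c y ->
  alpha f c x y ^+ 2 - beta f x y ^+ 2 = f (hd x) ^+ 2 * phi c y.
Proof.
move=> phi_gt0; rewrite /alpha /beta exprMn sqr_sqrtr; first by ring.
by rewrite addr_ge0 ?sqr_ge0// ltW.
Qed.

(** A negative radicand makes alpha vanish, and then alpha^2 - beta^2 <= 0. *)
Lemma phi_gt0_of_alpha_beta x y : U x ->
  0 < alpha f c x y ^+ 2 - beta f x y ^+ 2 -> 0 < phi c y.
Proof.
move=> Ux; have f0 := f_pos Ux; rewrite /alpha /beta !exprMn -mulrBr.
rewrite pmulr_rgt0 ?exprn_gt0// => h.
have [le0|gt0] := leP (hd y ^+ 2 + phi c y) 0.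
  move: h; rewrite (ler0_sqrtr le0) expr0n sub0r oppr_gt0 => h.
  by have := lt_le_trans h (sqr_ge0 (hd y)); rewrite ltxx.
by move: h; rewrite sqr_sqrtr ?ltW// addrC addKr.
Qed.

Lemma sqrt_alpha_beta x y : U x -> 0 < phi c y ->
  Num.sqrt (alpha f c x y ^+ 2 - beta f x y ^+ 2) = f (hd x) * rho c y.
Proof.
move=> Ux phi_gt0; rewrite sqr_alpha_sub_beta// sqrtrM ?sqr_ge0//.
by rewrite sqrtr_sqr gtr0_norm// f_pos.
Qed.

Lemma finslerE x y : U x -> cone y -> F x y = f (hd x) * profile c a y.
Proof.
move=> Ux [phi_gt0 w0]; have f0 : f (hd x) != 0 by rewrite gt_eqF// f_pos.
rewrite /finsler /= sqrt_alpha_beta// /beta /profile /weight.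
have -> : a * (f (hd x) * hd y) + f (hd x) * rho c y = f (hd x) * width c a y.
  by rewrite /width; ring.
rewrite -mulrA; congr (_ * (_ * expR _)).
by field; rewrite f0 w0.
Qed.

Lemma energyE x y : U x -> cone y ->
  energy F x y = f (hd x) ^+ 2 * profile c a y ^+ 2.
Proof. by move=> Ux Cy; rewrite /energy finslerE// exprMn. Qed.

Lemma partial_y_energyE i x y : U x -> cone y ->
  partial_y i (energy F) x y = f (hd x) ^+ 2 * dsq_profile c a y (e i).
Proof.
move=> Ux Cy; rewrite /partial_y.
apply: (derive_eq_on_open (@open_cone _ _ c a) (fun z => @energyE x z Ux) Cy).
have d2 := has_derive_sq_profile c_sym (e i) Cy.
by apply: has_derive_eq; [repeat form_derive_step|rewrite mulr0 addr0].
Qed.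

Lemma metric_tensorE x y : U x -> cone y ->
  metric_tensor F x y
  = \matrix_(i, j) (f (hd x) ^+ 2 / 2 * hess_sq_profile c a y (e i) (e j)).
Proof.
move=> Ux Cy; apply/matrixP => i j; rewrite !mxE [_ / 2]mulrC -mulrA.
congr (_ * _); rewrite /partial_y.
apply: (derive_eq_on_open (@open_cone _ _ c a)
  (fun z => @partial_y_energyE j x z Ux) Cy).
have d2 := has_derive_dsq_profile c_sym (e i) (e j) Cy.
by apply: has_derive_eq; [repeat form_derive_step|rewrite mulr0 addr0].
Qed.

Lemma metric_tensor_mul x y v i : U x -> cone y ->
  (metric_tensor F x y *m v^T) i 0
  = f (hd x) ^+ 2 / 2 * hess_sq_profile c a y (e i) v.
Proof.
move=> Ux Cy; rewrite metric_tensorE// mxE.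
rewrite -(sum_linear (hess_sq_profile_linear a c_sym y (e i)) v) mulr_sumr.
by apply: eq_bigr => j _; rewrite !mxE mulrA.
Qed.

(** A vector of the kernel is orthogonal for the Hessian to all basis vectors,
    hence to all vectors. *)
Lemma metric_tensor_unit x y : U x -> cone y -> metric_tensor F x y \in unitmx.
Proof.
move=> Ux Cy; rewrite -unitmx_tr unitmxE unitfE; apply/negP => /det0P[v v0 gv].
have f0 : f (hd x) != 0 by rewrite gt_eqF// f_pos.
move/eqP: v0; apply.
apply: (hess_sq_profile_nondegenerate c_sym a_neq0 c_unit Cy) => z.
have hsym j : hess_sq_profile c a y (e j) v = 0.
  have := metric_tensor_mul v j Ux Cy.
  rewrite -[metric_tensor F x y]trmxK -trmx_mul gv mxE mxE => /esym/eqP.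
  rewrite mulf_eq0 (negbTE (_ : f (hd x) ^+ 2 / 2 != 0)) => [/eqP //|].
  by rewrite mulf_neq0 ?invr_eq0 ?pnatr_eq0// expf_neq0.
have hlin k p q : hess_sq_profile c a y (k *: p + q) v
    = k * hess_sq_profile c a y p v + hess_sq_profile c a y q v.
  by rewrite /hess_sq_profile (cform_linear c_sym) cformDl cformZl !mxE; ring.
by rewrite -(sum_linear hlin z) big1// => j _; rewrite hsym mul0r.
Qed.

(** Since the metric tensor is invertible wherever F is smooth and nonzero, the
    domain is open in y for fixed x; formulas on it may be differentiated. *)
Lemma finsler_domainP x y : D (x, y) <-> U x /\ cone y.
Proof.
have wE : U x -> 0 < phi c y -> a * beta f x y
    + Num.sqrt (alpha f c x y ^+ 2 - beta f x y ^+ 2)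
    = f (hd x) * width c a y.
  by move=> Ux phi_gt0; rewrite sqrt_alpha_beta// /beta /width; ring.
split=> [[/= Ux /(phi_gt0_of_alpha_beta Ux) phi_gt0]|[Ux [phi_gt0 w0]]].
  by rewrite wE// mulf_eq0 negb_or => /andP[].
have f0 := f_pos Ux; split => //=.
- by rewrite sqr_alpha_sub_beta// mulr_gt0// exprn_gt0.
- by rewrite wE// mulf_neq0// gt_eqF.
- exact: metric_tensor_unit.
Qed.

Lemma has_derive_sq_conformal x r : U x ->
  has_derive x (e r) (fun x => f (hd x) ^+ 2)
    (2 * f (hd x) * derive1 f (hd x) * e r 0 ord0).
Proof.
move=> Ux; apply: has_derive_eq.
  apply: has_deriveX; apply: has_derive_comp; last exact: has_derive_coord.
  exact/derivableP/f_derivable.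
by rewrite derive1E expr1 !mulrA.
Qed.

(** The x-derivatives only act on the factor f^2, so the right-hand side of the
    spray equation is 2 f f' (s d(N^2) - N^2 dy^1), which by [hess_spray_dir] is
    4 f'/f times the metric tensor applied to T. *)
Lemma spray_coefE i x y : U x -> cone y ->
  spray_coef F i x y = tau x * spray_dir c a y 0 i.
Proof.
move=> Ux Cy; have f0 : f (hd x) != 0 by rewrite gt_eqF// f_pos.
set T := spray_dir c a y.
have dxE (G : 'rV[R]_m.+1 -> 'rV[R]_m.+1 -> R) k r :
    (forall z, U z -> G z y = f (hd z) ^+ 2 * k) ->
    partial_x r G x y = 2 * f (hd x) * derive1 f (hd x) * k * e r 0 ord0.
  move=> GE; rewrite /partial_x; apply: (derive_eq_on_open U_open GE Ux).
  have df := has_derive_sq_conformal r Ux.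
  apply: has_derive_eq; first by repeat form_derive_step.
  by rewrite mulr0 add0r mulrC mulrAC.
have rhsE h : \sum_r y 0 r * partial_x r (partial_y h (energy F)) x y
     - partial_x h (energy F) x y
     = 4 * tau x * (metric_tensor F x y *m T^T) h 0.
  rewrite metric_tensor_mul// (hess_spray_dir c_sym a_neq0)//.
  rewrite (@dxE _ (profile c a y ^+ 2)); last by move=> z Uz; rewrite energyE.
  have dyE r := @dxE (partial_y h (energy F)) _ r
    (fun z Uz => partial_y_energyE h Uz Cy).
  under eq_bigr => r _ do rewrite dyE.
  rewrite big_ord_recl big1 ?addr0; last first.
    by move=> r _; rewrite mxE /= !mulr0.
  by rewrite [e ord0 0 ord0]mxE !eqxx mulr1; field.
rewrite /spray_coef; under eq_bigr => h _ do rewrite rhsE.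
transitivity (tau x * (invmx (metric_tensor F x y)
                        *m (metric_tensor F x y *m T^T)) i 0).
  rewrite [in RHS]mxE !mulr_sumr; apply: eq_bigr => h _.
  by field.
by rewrite mulKmx ?metric_tensor_unit// mxE.
Qed.

Lemma berwald_tensorE h i j k x y : U x -> cone y ->
  berwald_tensor F h i j k x y
  = if h == ord0 then 0 else tau x * d3spray c a y (e i) (e j) (e k) 0 h.
Proof.
move=> Ux Cy; rewrite /berwald_tensor /partial_y.
apply: (third_derive_spray_dir c_sym a_neq0 (e i) (e j) (e k) _ Cy) => z Cz.
exact: spray_coefE.
Qed.

(** The Berwald tensor has no first component; the others are contracted with
    the differential of F, which is proportional to B(y, .) there. *)
Lemma landsberg_tensor0 i j k x y : U x -> cone y ->
  landsberg_tensor F i j k x y = 0.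
Proof.
move=> Ux Cy; have [phi_gt0 w0] := Cy.
suff sum0 : \sum_h partial_y h F x y * berwald_tensor F h i j k x y = 0.
  by rewrite /landsberg_tensor sum0 mulr0.
rewrite big_ord_recl (berwald_tensorE ord0 i j k Ux Cy) eqxx.
rewrite [X in X + _]mulr0 add0r.
have dF l : partial_y (lift ord0 l) F x y
    = f (hd x) * (weight c a y / width c a y) * cform c y (e (lift ord0 l)).
  rewrite /partial_y.
  apply: (derive_eq_on_open (@open_cone _ _ c a)
    (fun z => @finslerE x z Ux) Cy).
  have d1 := has_derive_profile c_sym (e (lift ord0 l)) Cy.
  apply: has_derive_eq; first by repeat form_derive_step.
  by rewrite mxE /=; field.
under eq_bigr => l _ do
  rewrite dF (berwald_tensorE (lift ord0 l) i j k Ux Cy) mulrACA.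
by rewrite -mulr_sumr sum_cform_delta cform_d3spray// mulr0.
Qed.

Lemma not_berwald x y : (1 < m)%N -> U x -> derive1 f (hd x) != 0 ->
  cone y -> ~ is_berwald D F.
Proof.
move=> m_gt1 Ux df0 Cy; have [phi_gt0 w0] := Cy => berw.
have f0 : f (hd x) != 0 by rewrite gt_eqF// f_pos.
apply: (d2rho_neq0 m_gt1 c_unit phi_gt0) => i j.
have := trace_d3spray a c_sym (e (lift ord0 i)) (e (lift ord0 j)) phi_gt0.
rewrite big1 => [/esym/eqP|l _].
  by rewrite mulf_eq0 mulf_eq0 invr_eq0 (negbTE a_neq0) pnatr_eq0 /= => /eqP.
have := berw x y (proj2 (finsler_domainP x y) (conj Ux Cy))
  (lift ord0 l) (lift ord0 i) (lift ord0 j) (lift ord0 l).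
rewrite berwald_tensorE//= => /eqP; rewrite mulf_eq0 mulf_eq0 invr_eq0.
by rewrite (negbTE f0) (negbTE df0) /= => /eqP.
Qed.

End Finsler.

(** Replacing y^1 by 0 does not change phi and makes w = u > 0. *)
Lemma cone_nonempty (R : realType) (m : nat) (c : 'M[R]_m) (a : R) :
  (exists y, 0 < phi c y) -> exists y, cone c a y.
Proof.
move=> [y phi_gt0].
pose y' : 'rV[R]_m.+1 := \row_i if i == ord0 then 0 else y 0 i.
have phiE : phi c y' = phi c y.
  by apply: eq_bigr => l _; apply: eq_bigr => k _; rewrite !mxE.
exists y'; split; rewrite ?phiE// /width mxE eqxx mulr0 add0r.
by apply: rho_neq0; rewrite phiE.
Qed.

Unset Implicit Arguments.

Theorem theorem4p4 (R : realType) (m : nat) (U : set 'rV[R]_m.+1)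
    (f : R -> R) (c : 'M[R]_m) (a : R)
    (n_ge3 : (3 <= m.+1)%N)
    (U_open : open U)
    (f_smooth : smooth_on [set x 0 ord0 | x in U] f)
    (f_pos : forall x, U x -> 0 < f (x 0 ord0))
    (f'_neq0 : exists2 x, U x & derive1 f (x 0 ord0) != 0)
    (c_sym : c^T = c)
    (c_nonsing : c \in unitmx)
    (phi_pos_somewhere : exists y, 0 < phi c y)
    (a_neq0 : a != 0) :
  let F := finsler f c a in
  let D := finsler_domain U f c a in
  [/\ is_landsberg D F,
      ~ is_berwald D F &
      forall x y, D (x, y) ->
        let f1 := f (x 0 ord0) in
        let df1 := derive1 f (x 0 ord0) in
        let al := alpha f c x y in
        let be := beta f x y in
        let P := (y 0 ord0 + (a * f1)^-1 * Num.sqrt (al ^+ 2 - be ^+ 2))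
                 * (df1 / f1) in
        spray_coef F ord0 x y =
          ((2 * f1 ^+ 2 * y 0 ord0 ^+ 2 - al ^+ 2) / (2 * f1 ^+ 2)
           + (a ^+ 2 - 1) / (2 * a ^+ 2) * ((al ^+ 2 - be ^+ 2) / f1 ^+ 2))
          * (df1 / f1)
        /\ forall l : 'I_m,
             spray_coef F (lift ord0 l) x y = P * y 0 (lift ord0 l)].
Proof.
move=> F D.
have f_derivable x : U x -> derivable f (x 0 ord0) 1.
  by move=> Ux; apply: (f_smooth 0%N); exists x.
have domP x y := finsler_domainP f_pos c_sym c_nonsing a_neq0 x y.
split.
- move=> x y /domP[Ux Cy] i j k.
  exact: (landsberg_tensor0 U_open f_derivable f_pos c_sym c_nonsing a_neq0).
- have [x Ux df0] := f'_neq0.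
  have [y Cy] := cone_nonempty a phi_pos_somewhere.
  exact: (not_berwald U_open f_derivable f_pos c_sym c_nonsing a_neq0 n_ge3 Ux
    df0 Cy).
- move=> x y /domP[Ux Cy] f1 df1 al be P.
  have [phi_gt0 _] := Cy.
  have f0 : f1 != 0 by rewrite gt_eqF// f_pos.
  have al2 : al ^+ 2 = f1 ^+ 2 * (y 0 ord0 ^+ 2 + phi c y).
    by rewrite /al /alpha exprMn sqr_sqrtr// addr_ge0 ?sqr_ge0// ltW.
  have spE i :=
    spray_coefE U_open f_derivable f_pos c_sym c_nonsing a_neq0 i Ux Cy.
  split=> [|l].
  + rewrite [LHS]spE spray_dir1 /slope sqr_alpha_sub_beta// -/f1 -/df1 al2.
    by rewrite -sqr_rho//; field; rewrite a_neq0 f0.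
  + rewrite [LHS]spE spray_dir_lift /slope /P (sqrt_alpha_beta f_pos)//.
    rewrite -/f1 -/df1.
    by field; rewrite a_neq0 f0.
Qed.
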